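(* Let $G=(V,E)$ be a simple undirected graph and let $F=\{h\}\cup P\subseteq V$, $|P|\ge 4$, be a subset of vertices inducing a fan graph in $G$ with hub $h$. Let $|P|=3q+r$, where $q$ is a positive integer and $r\in\{0,1,2\}$. Then the inequality $$\sum_{i\in P}x_i+\left(2(q-1)+\left\lfloor\frac{2(r+1)}{3}\right\rfloor\right)x_h\le 2q+\left\lfloor\frac{2(r+1)}{3}\right\rfloor$$ is valid for $\mathscr{P}_{IUC}(G)$, and it induces a facet of $\mathscr{P}_{IUC}(G[F])$ if and only if $r\ne 2$.
   Context: All graphs are finite, simple and undirected. A subset $U\subseteq V$ of the vertices of $G=(V,E)$ is an independent union of cliques (IUC) if every connected component of the induced subgraph $G[U]$ is a complete graph (equivalently, $G[U]$ has no induced path on three vertices). The IUC polytope $\mathscr{P}_{IUC}(G)\subseteq\mathbb{R}^{V}$ is the convex hull of the incidence vectors of all IUCs of $G$. A set $F=\{h\}\cup P$ ($h\notin P$) induces a fan graph with hub $h$ if $G[P]$ is a path graph and $h$ is adjacent to every vertex of $P$. *)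

(* Defs.v *)
From mathcomp Require Import all_boot all_order all_algebra.
From mathcomp Require Import classical_sets reals.

Set Implicit Arguments.
Unset Strict Implicit.
Unset Printing Implicit Defensive.

Import Order.TTheory GRing.Theory Num.Theory.

Local Open Scope ring_scope.

Record sgraph (V : finType) := SGraph {
  adj :> rel V;
  adj_sym : symmetric adj;
  adj_irr : irreflexive adj }.

Section Graphs.
Variables (V : finType) (G : sgraph V).

Lemma induced_sym (U : {set V}) :
  symmetric (fun x y : {x : V | x \in U} => G (val x) (val y)).
Proof. by move=> x y; exact: adj_sym. Qed.

Lemma induced_irr (U : {set V}) :
  irreflexive (fun x y : {x : V | x \in U} => G (val x) (val y)).
Proof. by move=> x; exact: adj_irr. Qed.

(* The vertex set of G[U] is the subtype U, so its polytope lives in R^U. *)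
Definition induced (U : {set V}) : sgraph {x : V | x \in U} :=
  SGraph (@induced_sym U) (@induced_irr U).

Definition component (x : V) : {set V} := [set y | connect G x y].

Definition is_clique (C : {set V}) : Prop :=
  {in C &, forall x y, x != y -> G x y}.

Definition is_path_graph : Prop :=
  exists (n : nat) (f : 'I_n -> V), bijective f /\
    forall i j : 'I_n, G (f i) (f j) = (i.+1 == j) || (j.+1 == i).

End Graphs.

Definition is_iuc (V : finType) (G : sgraph V) (U : {set V}) : Prop :=
  forall x, is_clique (induced G U) (component (induced G U) x).

Definition induces_fan (V : finType) (G : sgraph V) (h : V) (P : {set V}) :
    Prop :=
  [/\ h \notin P, is_path_graph (induced G P) & {in P, forall v, G h v}].

(* The codomain is R^o, i.e. R seen as a module over itself, because that is
   what equips {ffun V -> _} with its pointwise R-module structure. *)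
Definition vec (R : realType) (V : finType) := {ffun V -> R^o}.

Section Polytopes.
Variables (R : realType) (V : finType).
Local Notation vec := (vec R V).
Implicit Types (S : set vec) (L : vec -> R) (b : R).

Definition conv_hull S : set vec := fun x =>
  exists (n : nat) (p : 'I_n -> vec) (c : 'I_n -> R),
    [/\ forall i, S (p i), forall i, 0 <= c i, \sum_i c i = 1
      & x = \sum_i c i *: p i].

Definition affinely_independent (n : nat) (p : 'I_n -> vec) : Prop :=
  forall c : 'I_n -> R,
    \sum_i c i = 0 -> \sum_i c i *: p i = 0 -> forall i, c i = 0.

(* The dimension is one less than the largest number of affinely independent
   points; in particular the empty set has dimension -1. *)
Definition has_dim S (d : int) : Prop :=
  exists n : nat,
    [/\ d = n%:Z - 1,
        exists p : 'I_n -> vec, (forall i, S (p i)) /\ affinely_independent p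
      & forall (m : nat) (p : 'I_m -> vec),
          (forall i, S (p i)) -> affinely_independent p -> (m <= n)%N].

Definition valid_ineq S L b : Prop := forall x, S x -> L x <= b.

Definition facet_inducing S L b : Prop :=
  valid_ineq S L b /\
  exists d : int,
    has_dim S d /\ has_dim (fun x => S x /\ L x = b) (d - 1).

Definition incidence (U : {set V}) : vec := [ffun v => (v \in U)%:R].

Definition iuc_polytope (G : sgraph V) : set vec :=
  conv_hull (fun x => exists2 U : {set V}, is_iuc G U & x = incidence U).

Definition fan_lhs (P : {set V}) (h : V) (c : R) (x : vec) : R :=
  \sum_(i in P) x i + c * x h.

End Polytopes.

Arguments iuc_polytope R {V} G _.

(* P and h as a vertex set and a vertex of the induced subgraph on {h} + P. *)
Definition fan_path (V : finType) (h : V) (P : {set V}) :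
    {set {x : V | x \in h |: P}} := [set i | val i \in P].

Definition fan_hub (V : finType) (h : V) (P : {set V}) :
    {x : V | x \in h |: P} := exist _ h (setU11 h P).

(* Main.v *)
(* An IUC containing the hub meets P in a clique, hence in at most an edge,
   while an IUC avoiding the hub contains no three consecutive vertices of the
   path and so at most 2q + r of them.  The IUCs attaining equality are thus
   {h} + edge (n - 1 of them, n = |P|) and the maximum words without 111.

   For r < 2, the word 110110... and the word obtained from it by exchanging the
   entries 3q - 2 and 3q - 1 complete the n - 1 edges to n + 1 affinely
   independent points.

   For r = 2 the only maximum word is 110110...11, so all tight IUCs satisfy the
   additional equation sum_i (-1)^i x_i = 0, and the face has codimension at
   least 2. *)

Require Import Defs.
From mathcomp Require Import all_boot all_order all_algebra.
From mathcomp Require Import classical_sets reals.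
From mathcomp Require Import zify ring lra.

Set Implicit Arguments.
Unset Strict Implicit.
Unset Printing Implicit Defensive.

Import Order.TTheory GRing.Theory Num.Theory.

Local Open Scope ring_scope.

(** * IUCs as sets without an induced path on three vertices *)

Section IndependentUnionsOfCliques.
Variables (V : finType) (G : sgraph V).

Lemma is_iucP (U : {set V}) :
  is_iuc G U <->
  (forall x y z, x \in U -> y \in U -> z \in U ->
     G x y -> G y z -> x != z -> G x z).
Proof.
split=> [iucU x y z Ux Uy Uz Gxy Gyz xz | noP3 x].
  pose x' : {v | v \in U} := exist _ x Ux.
  pose y' : {v | v \in U} := exist _ y Uy.
  pose z' : {v | v \in U} := exist _ z Uz.
  apply: (iucU x' x' z'); rewrite ?inE ?connect0 //.
  by apply: (@connect_trans _ _ y'); exact: connect1.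
(* Induction along a walk from [u]: once its second vertex is adjacent to the end, excluding induced
   paths on three vertices makes [u] adjacent to the end too. *)
have conn u v : connect (induced G U) u v -> u != v -> G (val u) (val v).
  case/connectP=> p + ->; elim: p u => [|w p IH] u /=; first by rewrite eqxx.
  case/andP=> Guw pathp uv.
  have [<-//|wv] := eqVneq w (last w p).
  exact: noP3 (valP u) (valP w) (valP _) Guw (IH _ pathp wv) uv.
move=> y z; rewrite !inE => xy xz; apply: conn.
by rewrite -(same_connect (sym_connect_sym (adj_sym (induced G U))) xy).
Qed.

End IndependentUnionsOfCliques.

(** * Zero-one words: weights and alternating sums *)

Section BinaryWords.
Implicit Types (g : nat -> bool) (n q r : nat).

(** Left-hand side of the extra equation that tight IUCs satisfy when r = 2. *)
Definition alt_sum (R : pzRingType) n (x : nat -> R) : R :=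
  \sum_(i < n) (-1) ^+ i * x i.

Definition no_three_consecutive n g : Prop :=
  forall i, (i.+2 < n)%N -> ~~ [&& g i, g i.+1 & g i.+2].

(** Trace on the path of an IUC containing the hub: at most two ones, and two only if they are
    neighbours. *)
Definition all_consecutive n g : Prop :=
  forall i j, (i < j < n)%N -> g i -> g j -> j = i.+1.

Lemma no_three_consecutive_leq n m g :
  (m <= n)%N -> no_three_consecutive n g -> no_three_consecutive m g.
Proof. by move=> mn gn i im; apply: gn; exact: leq_trans mn. Qed.

(** By induction on q, since the last three entries hold at most two ones. *)
Lemma no_three_consecutive_sum q r g :
  no_three_consecutive (3 * q + r) g ->
  (\sum_(i < 3 * q + r) g i <= 2 * q + r)%N.
Proof.
elim: q => [_|q IH].
  rewrite !muln0 !add0n -[leqRHS]card_ord -sum1_card.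
  by apply: leq_sum => i _; case: (g i).
have -> : (3 * q.+1 + r = (3 * q + r).+3)%N by lia.
move=> g3; have := g3 _ (ltnSn _).
have := IH (no_three_consecutive_leq (leqW (leqW (leqnSn _))) g3).
rewrite !big_ord_recr /=; do 3!case: (g _) => //=; lia.
Qed.

(** Knowing that the last two entries are ones carries the induction: the next entry must then be
    zero and the two after it ones. Ones thus come in adjacent pairs, which cancel in the
    alternating sum. *)
Lemma no_three_consecutive_alt_sum (R : pzRingType) q g :
  no_three_consecutive (3 * q + 2) g ->
  (\sum_(i < 3 * q + 2) g i = 2 * q + 2)%N ->
  [/\ g (3 * q)%N, g (3 * q).+1
    & alt_sum (3 * q + 2) (fun i => (g i)%:R) = 0 :> R].
Proof.
rewrite /alt_sum; elim: q => [_|q IH].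
  rewrite !muln0 !add0n !big_ord_recr !big_ord0 /=.
  do 2!case: (g _) => //=; split=> //.
  by rewrite add0r expr0 expr1 !mulr1 subrr.
have -> : (3 * q.+1 + 2 = (3 * q + 2).+3)%N by lia.
have -> : (3 * q.+1 = (3 * q + 2).+1)%N by lia.
move=> g3; have g3q := no_three_consecutive_leq (leqW (leqW (leqnSn _))) g3.
have := no_three_consecutive_sum g3q.
have := g3 (3 * q)%N; have := g3 _ (ltnSn _).
rewrite !big_ord_recr /=; set a := (\sum_(i < 3 * q + 2) _)%N.
move=> last3 g012 le2 sumE.
(* The last three entries contribute at most 2 and the prefix at most 2q + 2, so equality makes the
   prefix maximal. *)
have [|g0 g1 ->] := IH g3q.
  by move: last3 sumE le2; do 3!case: (g _) => //=; rewrite -/a; lia.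
have g2 : g (3 * q + 2)%N = false.
  by apply: negbTE; move: g012; rewrite g0 g1 addn2 /=; apply; lia.
have a2 : a = (2 * q + 2)%N.
  by move: last3 sumE le2; do 3!case: (g _) => //=; rewrite -/a; lia.
move: sumE; rewrite g2 a2.
case: (g _.+1) => //=; case: (g _.+2) => //=; try lia.
move=> _; split=> //.
by rewrite !mulr1 mulr0 !add0r [X in _ + X]exprS mulN1r subrr.
Qed.

(** If the last entry is a one, only its left neighbour can be another, and neighbours carry
    opposite signs. *)
Lemma all_consecutive_alt_sum (R : pzRingType) n g :
  all_consecutive n g ->
  (\sum_(i < n) g i <= 2)%N /\
  ((\sum_(i < n) g i = 2)%N -> alt_sum n (fun i => (g i)%:R) = 0 :> R).
Proof.
rewrite /alt_sum; elim: n => [_|n IH gn]; first by rewrite !big_ord0.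
rewrite !big_ord_recr /=; case gnT: (g n); last first.
  rewrite addn0 mulr0 addr0; apply: IH => i j ij.
  by apply: gn; lia.
case: n IH gn gnT => [|n] IH gn gnT; first by rewrite !big_ord0 !add0n.
have g0 (i : 'I_n) : g i = false.
  apply/negP => gi; have := gn i n.+1 _ gi gnT; have := ltn_ord i; lia.
rewrite !big_ord_recr /= !big1 => [|i _|i _]; try by rewrite g0 ?mulr0.
case: (g n) => //=; split=> // _.
by rewrite add0r !mulr1 [X in _ + X]exprS mulN1r subrr.
Qed.

End BinaryWords.

(** * Affine independence, dimension, and faces of convex hulls *)

Section AffineGeometry.
Variables (R : realType) (V : finType).
Implicit Types (L : vec R V -> R) (S : set (vec R V)) (x : vec R V).

Lemma scalar_sum L (I : finType) (c : I -> R) (p : I -> vec R V) :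
  scalar L -> L (\sum_i c i *: p i) = \sum_i c i * L (p i).
Proof.
move=> linL.
have L0 : L 0 = 0.
  have := linL 1 0 0; rewrite scaler0 addr0 mul1r => /eqP.
  by rewrite -[X in X == _]addr0 (inj_eq (addrI _)) eq_sym => /eqP.
have LD : {morph L : x y / x + y}
  by move=> x y; rewrite -{1}[x]scale1r linL mul1r.
rewrite (big_morph L LD L0); apply: eq_bigr => i _.
by rewrite -[c i *: _]addr0 linL L0 addr0.
Qed.

Lemma vec_sum_incidence x : x = \sum_v x v *: incidence R [set v].
Proof.
apply/ffunP => u; rewrite sum_ffunE (bigD1 u) //= big1 => [|v vu].
  by rewrite !ffunE set11 addr0 /GRing.scale /= mulr1.
by rewrite !ffunE inE eq_sym (negPf vu) scaler0.
Qed.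

(* The vectors (p i, 1) of R^(|V|+1) are linearly independent, and are
   annihilated by the k independent forms (L j, - b j). *)
Lemma affinely_independent_leq (m k : nat) (p : 'I_m -> vec R V)
    (L : 'I_k -> vec R V -> R) (b : 'I_k -> R) :
  affinely_independent p -> (forall j, scalar (L j)) ->
  (forall i j, L j (p i) = b j) ->
  (forall d : 'I_k -> R, (forall x, \sum_j d j * L j x = 0) ->
     forall j, d j = 0) ->
  (m + k <= #|V|.+1)%N.
Proof.
move=> affp linL Lp freeL.
pose A : 'M[R]_(m, #|V| + 1) :=
  row_mx (\matrix_(i, j) p i (enum_val j)) (const_mx 1).
pose B : 'M[R]_(#|V| + 1, k) :=
  col_mx (\matrix_(i, j) L j (incidence R [set enum_val i])) (\row_j - b j).
have Lsum j x :
    \sum_(i < #|V|) x (enum_val i) * L j (incidence R [set enum_val i]) = L j x.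
  rewrite [in RHS](vec_sum_incidence x) scalar_sum //.
  by rewrite [RHS](reindex (@enum_val V V)) //; exact/onW_bij/enum_val_bij.
have freeA : row_free A.
  apply: inj_row_free => c; rewrite mul_mx_row => /eqP.
  rewrite -row_mx0 => /eqP /eq_row_mx [cp c1].
  apply/rowP => i; rewrite mxE; apply: (affp (c 0)).
    move/rowP/(_ 0): c1; rewrite !mxE => c1; rewrite -[RHS]c1.
    by apply: eq_bigr => j _; rewrite mxE mulr1.
  apply/ffunP => v; move/rowP/(_ (enum_rank v)): cp.
  rewrite !mxE sum_ffunE ffunE => cpv; rewrite -[RHS]cpv.
  by apply: eq_bigr => j _; rewrite !mxE enum_rankK ffunE.
have freeB : row_free B^T.
  apply: inj_row_free => d; rewrite tr_col_mx mul_mx_row => /eqP.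
  rewrite -row_mx0 => /eqP /eq_row_mx [dL _].
  apply/rowP => j; rewrite mxE; apply: (freeL (d 0)) => x.
  under eq_bigr => i _ do rewrite -Lsum mulr_sumr.
  rewrite exchange_big big1 //= => i _.
  move/rowP/(_ i): dL; rewrite !mxE => dLi.
  transitivity (x (enum_val i) * 0); last by rewrite mulr0.
  rewrite -[in RHS]dLi mulr_sumr.
  by apply: eq_bigr => l _; rewrite !mxE mulrCA.
have AB0 : A *m B = 0.
  apply/matrixP => i j; rewrite mul_row_col !mxE big_ord1 !mxE mul1r.
  under eq_bigr => l _ do rewrite !mxE.
  by rewrite Lsum Lp subrr.
(* As the product vanishes, the ranks m and k of the factors sum to at most |V| + 1. *)
have := mulmx0_rank_max AB0.
move/eqP: freeA => ->; move/eqP: freeB; rewrite mxrank_tr => ->.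
by rewrite addn1.
Qed.

Lemma affinely_independent_card (m : nat) (p : 'I_m -> vec R V) :
  affinely_independent p -> (m <= #|V|.+1)%N.
Proof.
move=> affp; rewrite -[m]addn0.
apply: (@affinely_independent_leq _ _ p (fun _ _ => 0) (fun _ => 0)) => //.
- by case.
- by move=> d _ [].
Qed.

Lemma affinely_independent_hyperplane (m : nat) (p : 'I_m -> vec R V) L b x :
  affinely_independent p -> scalar L -> (forall i, L (p i) = b) -> L x != 0 ->
  (m <= #|V|)%N.
Proof.
move=> affp linL Lp Lx; rewrite -ltnS -addn1.
apply: (@affinely_independent_leq _ _ p (fun=> L) (fun=> b)) => // d dL j.
have /eqP := dL x; rewrite big_ord1 mulf_eq0 (negPf Lx) orbF => /eqP.
by rewrite (ord1 j).
Qed.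

Lemma affinely_independent_codim2 (m : nat) (p : 'I_m -> vec R V)
    (L1 L2 : vec R V -> R) b1 b2 :
  affinely_independent p -> scalar L1 -> scalar L2 ->
  (forall i, L1 (p i) = b1) -> (forall i, L2 (p i) = b2) ->
  (forall d1 d2, (forall x, d1 * L1 x + d2 * L2 x = 0) -> d1 = 0 /\ d2 = 0) ->
  (m < #|V|)%N.
Proof.
move=> affp lin1 lin2 Lp1 Lp2 free12.
have ord2 (j : 'I_2) : j = ord0 \/ j = ord_max.
  by case: j => [[|[|//]] j2]; [left|right]; apply: val_inj.
rewrite -ltnS -addn2.
apply: (@affinely_independent_leq _ _ p
          (fun j => if j == ord0 then L1 else L2)
          (fun j => if j == ord0 then b1 else b2)) => //.
- by move=> j; case: ifP.
- by move=> i j; case: ifP.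
move=> d dL; have [x|d1 d2 j] := free12 (d ord0) (d ord_max).
  rewrite -[RHS](dL x) big_ord_recl big_ord1 /=.
  by congr (_ + d _ * _); exact: val_inj.
by case: (ord2 j) => ->.
Qed.

(** Pins down the dimension that [facet_inducing] quantifies existentially. *)
Lemma has_dim_uniq S (d e : int) : has_dim S d -> has_dim S e -> d = e.
Proof.
move=> [m [-> [p [Sp affp]] maxm]] [n [-> [p' [Sp' affp']] maxn]].
by have := maxm _ _ Sp' affp'; have := maxn _ _ Sp affp; lia.
Qed.

Lemma conv_hull_sub S x : S x -> conv_hull S x.
Proof.
move=> Sx; exists 1%N, (fun=> x), (fun=> 1).
by split=> //; rewrite big_ord1 // scale1r.
Qed.

Lemma conv_hull_valid S L b :
  scalar L -> (forall x, S x -> L x <= b) -> valid_ineq (conv_hull S) L b.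
Proof.
move=> linL LS x [n [p [c [Sp c0 c1 ->]]]].
rewrite scalar_sum // -[b]mul1r -c1 mulr_suml.
by apply: ler_sum => i _; rewrite ler_wpM2l ?LS.
Qed.

(** The products of weight and slack are nonnegative and sum to zero, so only points tight for [L]
    carry weight. *)
Lemma conv_hull_face S L L' b b' :
  scalar L -> scalar L' -> (forall x, S x -> L x <= b) ->
  (forall x, S x -> L x = b -> L' x = b') ->
  forall x, conv_hull S x -> L x = b -> L' x = b'.
Proof.
move=> linL linL' LS tight x [n [p [c [Sp c0 c1 ->]]]].
rewrite !scalar_sum // => Lb.
have gap0 : \sum_i c i * (b - L (p i)) = 0.
  under eq_bigr do rewrite mulrBr.
  by rewrite big_split /= sumrN -mulr_suml c1 mul1r Lb subrr.
have gap i : c i * (b - L (p i)) = 0.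
  move/eqP: gap0; rewrite psumr_eq0 => [/allP/(_ i)|j _].
    by rewrite mem_index_enum => /(_ isT)/eqP.
  by rewrite mulr_ge0 // subr_ge0 LS.
rewrite -[b']mul1r -c1 mulr_suml; apply: eq_bigr => i _.
move/eqP: (gap i); rewrite mulf_eq0 subr_eq0 => /orP[/eqP->|/eqP Lpi].
  by rewrite !mul0r.
by rewrite (tight (p i)).
Qed.

(** The empty set and the singletons are IUCs, and their incidence vectors span a full-dimensional
    simplex. *)
Lemma iuc_polytope_has_dim (G : sgraph V) :
  has_dim (iuc_polytope R G) #|V|%:Z.
Proof.
exists #|V|.+1; split; first by lia.
  pose U (i : 'I_#|V|.+1) : {set V} :=
    if unlift ord0 i is Some j then [set enum_val j] else finset.set0.
  exists (fun i => incidence R (U i)); split=> [i|c c0 cU].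
    apply: conv_hull_sub; exists (U i) => //; apply/is_iucP => x y z.
    rewrite /U; case: unliftP => [j _|_]; rewrite !inE //.
    by move=> /eqP-> _ /eqP->; rewrite eqxx.
  (* The coordinate at a vertex isolates the coefficient of its singleton; that of the empty set, at
     [ord0], then vanishes because the coefficients sum to zero. *)
  have cl j : c (lift ord0 j) = 0.
    move/ffunP/(_ (enum_val j)): cU.
    rewrite sum_ffunE ffunE (bigD1 (lift ord0 j)) //=.
    rewrite big1 => [|i ij]; rewrite !ffunE /U.
      by rewrite liftK set11 addr0 /GRing.scale /= mulr1.
    case: unliftP ij => [k ->|_ _]; rewrite inE ?scaler0 //.
    rewrite (inj_eq lift_inj) (inj_eq enum_val_inj) eq_sym => /negPf->.
    by rewrite scaler0.
  move=> i; case: (unliftP ord0 i) => [j|] -> //.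
  by move: c0; rewrite big_ord_recl big1 ?addr0 // => j _; rewrite cl.
by move=> m p _; exact: affinely_independent_card.
Qed.

End AffineGeometry.

(** * Indicator sums and the encoding of fans *)

Lemma sum_nat_eq (n k : nat) : (\sum_(i < n) (i == k :> nat) = (k < n))%N.
Proof.
elim: n => [|n IH]; first by rewrite big_ord0.
by rewrite big_ord_recr /= IH ltnS; case: (ltngtP k n).
Qed.

(** [n %/ 3] counts the indices of residue 2; the additive form avoids truncated subtraction. *)
Lemma sum_mod3_neq2 (n : nat) :
  (\sum_(i < n) (i %% 3 != 2) + n %/ 3 = n)%N.
Proof.
elim: n => [|n IH]; first by rewrite big_ord0.
by rewrite big_ord_recr /=; move: (bigop _ _ _) IH => s; case: eqP => /= n3; lia.
Qed.

Lemma sum_mul_eq (R : pzRingType) (n k : nat) (y : nat -> R) :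
  \sum_(i < n) y i * (i == k :> nat)%:R = if (k < n)%N then y k else 0.
Proof.
elim: n => [|n IH]; first by rewrite big_ord0.
rewrite big_ord_recr /= IH; have [->|nk] := eqVneq n k.
  by rewrite ltnn ltnSn add0r mulr1.
by rewrite mulr0 addr0; have -> : (k < n.+1)%N = (k < n)%N by lia.
Qed.

(** The path is indexed by [nat] and constrained only below [n], so that words can use shifted
    indices without casts. The fan may be a proper part of the graph, so the record serves both G
    and G[F]. *)
Record fan_on (V : finType) (G : sgraph V) (h : V) (n : nat) (f : nat -> V) := {
  fan_inj : forall i j, (i < n)%N -> (j < n)%N -> f i = f j -> i = j;
  fan_neq_hub : forall i, (i < n)%N -> f i != h;
  fan_adj : forall i j, (i < n)%N -> (j < n)%N ->
    G (f i) (f j) = (i.+1 == j) || (j.+1 == i);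
  fan_adj_hub : forall i, (i < n)%N -> G h (f i) }.

(** * IUCs of a graph containing a fan, and validity of the inequality *)

Section Fan.
Variables (R : realType) (V : finType) (G : sgraph V).
Variables (h : V) (n : nat) (f : nat -> V) (fanf : fan_on G h n f).
Implicit Types (U : {set V}) (x : vec R V).

Definition fan_form (c : R) x : R := \sum_(i < n) x (f i) + c * x h.

Definition alt_form x : R := alt_sum n (fun i => x (f i)).

Lemma fan_form_scalar c : scalar (fan_form c).
Proof.
move=> a x y; rewrite /fan_form.
under eq_bigr do rewrite !ffunE.
rewrite !ffunE big_split /= -scaler_sumr /GRing.scale /=.
ring.
Qed.

Lemma alt_form_scalar : scalar alt_form.
Proof.
move=> a x y; rewrite /alt_form /alt_sum mulr_sumr -big_split /=.
apply: eq_bigr => i _; rewrite !ffunE /GRing.scale /=; ring.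
Qed.

Lemma fan_lhsE (P : {set V}) c x :
  P = [set f i | i : 'I_n] -> fan_lhs P h c x = fan_form c x.
Proof.
move=> ->; rewrite /fan_lhs big_imset //= => i j _ _ fij.
exact/val_inj/(fan_inj fanf (ltn_ord i) (ltn_ord j)).
Qed.

Lemma fan_form_incidence C U :
  fan_form C%:R (incidence R U) =
  (\sum_(i < n) (f i \in U) + C * (h \in U))%N%:R.
Proof.
rewrite /fan_form natrD natr_sum natrM ffunE.
by congr (_ + _); apply: eq_bigr => i _; rewrite ffunE.
Qed.

Lemma fan_iuc_no_three U :
  is_iuc G U -> no_three_consecutive n (fun i => f i \in U).
Proof.
move=> /is_iucP iucU i i2; apply/negP => /and3P[U0 U1 U2].
have i1 := ltnW i2; have i0 := ltnW i1.
have := iucU _ _ _ U0 U1 U2; rewrite !(fan_adj fanf) //.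
have -> : f i != f i.+2.
  by apply/eqP => /(fan_inj fanf i0 i2); lia.
by rewrite !eqxx => /(_ isT isT isT); lia.
Qed.

(** Two path vertices of [U] are joined through the hub, hence must be adjacent. *)
Lemma fan_iuc_hub U :
  is_iuc G U -> h \in U -> all_consecutive n (fun i => f i \in U).
Proof.
move=> /is_iucP iucU Uh i j /andP[ij jn] Ui Uj; have i_n := ltn_trans ij jn.
have := iucU _ _ _ Ui Uh Uj; rewrite (adj_sym G (f i) h) !(fan_adj_hub fanf) //.
rewrite (fan_adj fanf) //.
have -> : f i != f j by apply/eqP => /(fan_inj fanf i_n jn); lia.
by move=> /(_ isT isT isT); lia.
Qed.

(** With the hub, the path adds at most 2 to 2(q - 1) + r; without it, the bound on words applies.
    Here [r] stands for the floor in the inequality, which it equals when r < 3. *)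
Lemma fan_iuc_leq q r U :
  n = (3 * q + r)%N -> (0 < q)%N -> is_iuc G U ->
  (\sum_(i < n) (f i \in U) + (2 * (q - 1) + r) * (h \in U) <= 2 * q + r)%N.
Proof.
move=> nE q0 iucU; case: (boolP (h \in U)) => Uh /=.
  have [le2 _] := all_consecutive_alt_sum int (fan_iuc_hub iucU Uh).
  by move: le2 => /=; lia.
rewrite muln0 addn0.
move: (fan_iuc_no_three iucU); rewrite nE => /no_three_consecutive_sum; exact.
Qed.

Lemma fan_iuc_tight_alt q U :
  n = (3 * q + 2)%N -> (0 < q)%N -> is_iuc G U ->
  (\sum_(i < n) (f i \in U) + (2 * (q - 1) + 2) * (h \in U) = 2 * q + 2)%N ->
  alt_form (incidence R U) = 0.
Proof.
move=> nE q0 iucU tight.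
transitivity (alt_sum n (fun i => (f i \in U)%:R) : R).
  by apply: eq_bigr => i _; rewrite ffunE.
move: tight; case: (boolP (h \in U)) => Uh /= tight.
  have [_] := all_consecutive_alt_sum R (fan_iuc_hub iucU Uh).
  by apply => /=; lia.
have := fan_iuc_no_three iucU; move: tight; rewrite muln0 addn0 nE => sumE g3.
by have [] := no_three_consecutive_alt_sum R g3 sumE.
Qed.

Lemma fan_form_valid q r :
  n = (3 * q + r)%N -> (0 < q)%N ->
  valid_ineq (iuc_polytope R G)
    (fan_form (2 * (q - 1) + r)%N%:R) (2 * q + r)%N%:R.
Proof.
move=> nE q0; apply: conv_hull_valid; first exact: fan_form_scalar.
by move=> _ [U iucU ->]; rewrite fan_form_incidence ler_nat fan_iuc_leq.
Qed.

Definition fan_set (e : bool) (g : nat -> bool) : {set V} :=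
  [set v | (v == h) && e || [exists i : 'I_n, (v == f i) && g i]].

Lemma mem_fan_set_hub e g : (h \in fan_set e g) = e.
Proof.
rewrite inE eqxx /=; case: existsP => [[i]|]; last by rewrite orbF.
by rewrite eq_sym (negPf (fan_neq_hub fanf (ltn_ord i))).
Qed.

Lemma mem_fan_set e g i : (i < n)%N -> (f i \in fan_set e g) = g i.
Proof.
move=> i_n; rewrite inE (negPf (fan_neq_hub fanf i_n)) /=.
apply/existsP/idP => [[j /andP[/eqP fij]]|gi].
  by rewrite (fan_inj fanf i_n (ltn_ord j) fij).
by exists (Ordinal i_n); rewrite eqxx.
Qed.

Lemma fan_setP e g v :
  v \in fan_set e g ->
  (v = h /\ e) \/ (exists i, [/\ (i < n)%N, v = f i & g i]).
Proof.
rewrite inE => /orP[/andP[/eqP-> he]|/existsP[i /andP[/eqP-> gi]]]; first by left.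
by right; exists i.
Qed.

(** The set is a clique: the hub sees the whole path, and two ones of the word are neighbours. *)
Lemma fan_set_hub_iuc g : all_consecutive n g -> is_iuc G (fan_set true g).
Proof.
move=> gn; apply/is_iucP => x _ z Ux _ Uz _ _.
case: (fan_setP Ux) (fan_setP Uz) => [[-> _]|[i [i_n -> gi]]].
  case=> [[-> _]|[j [jn -> _]] _]; first by rewrite eqxx.
  exact: (fan_adj_hub fanf jn).
case=> [[-> _] _|[j [jn -> gj]]]; first by rewrite adj_sym; exact: (fan_adj_hub fanf i_n).
rewrite (fan_adj fanf) //; case: (ltngtP i j) => [ij _|ji _|->]; last by rewrite eqxx.
  by rewrite (gn i j) ?eqxx // ij.
by rewrite (gn j i) ?eqxx ?orbT // ji.
Qed.

(** Two steps along the path either return to their start or cover three consecutive positions. *)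
Lemma fan_set_path_iuc g :
  no_three_consecutive n g -> is_iuc G (fan_set false g).
Proof.
move=> g3; apply/is_iucP => x y z.
case/fan_setP=> [[]//|[i [i_n -> gi]]].
case/fan_setP=> [[]//|[j [jn -> gj]]].
case/fan_setP=> [[]//|[k [kn -> gk]]].
rewrite !(fan_adj fanf) // => /orP[] /eqP ij /orP[] /eqP jk.
- by subst j k; have := g3 i kn; rewrite gi gj gk.
- by have -> : i = k by [lia]; rewrite eqxx.
- by have -> : i = k by [lia]; rewrite eqxx.
- by subst j i; have := g3 k i_n; rewrite gi gj gk.
Qed.

End Fan.

(** * The words of the tight IUCs *)

Definition edge_word (k i : nat) : bool := (i == k) || (i == k.+1).

(** The word 110110..., whose prefixes of length 3q + r with r < 3 are maximum words without 111. *)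
Definition mod3_word (i : nat) : bool := (i %% 3 != 2)%N.

(* Differs from mod3_word exactly at p and p + 1, for p = 1 modulo 3. *)
Definition shifted_word (p i : nat) : bool :=
  (i != p) && ((i == p.+1) || mod3_word i).

Lemma edge_word_consecutive n k : all_consecutive n (edge_word k).
Proof. by move=> i j; rewrite /edge_word; lia. Qed.

Lemma edge_word_sum n k : (k.+1 < n)%N -> (\sum_(i < n) edge_word k i = 2)%N.
Proof.
move=> kn; transitivity (\sum_(i < n) ((i == k :> nat) + (i == k.+1 :> nat)))%N.
  by apply: eq_bigr => i _; rewrite /edge_word; case: eqP => // ->; lia.
by rewrite big_split /= !sum_nat_eq kn (ltnW kn).
Qed.

Lemma mod3_word_no_three n : no_three_consecutive n mod3_word.
Proof. by move=> i _; rewrite /mod3_word; lia. Qed.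

Lemma mod3_word_sum q r :
  (r < 3)%N -> (\sum_(i < 3 * q + r) mod3_word i = 2 * q + r)%N.
Proof.
move=> r3; have := sum_mod3_neq2 (3 * q + r).
by rewrite /mod3_word; move: (bigop _ _ _) => s; lia.
Qed.

(** Moving a one from 3q + 1 to 3q + 2 leaves room for one further entry only: for r = 2 the entries
    3q + 2, 3q + 3, 3q + 4 would all be ones. *)
Lemma shifted_word_no_three q r : (r < 2)%N ->
  no_three_consecutive (3 * q.+1 + r) (shifted_word (3 * q).+1).
Proof.
by move=> r2 i i_n; rewrite /shifted_word /mod3_word; lia.
Qed.

(** Free of subtraction, this form of the exchange sums over [nat] and casts into any ring. *)
Lemma shifted_wordE q i :
  (shifted_word (3 * q).+1 i + (i == (3 * q).+1) =
   mod3_word i + (i == (3 * q).+2))%N.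
Proof.
rewrite /shifted_word /mod3_word.
lia.
Qed.

Lemma shifted_word_sum q r : (r < 2)%N ->
  (\sum_(i < 3 * q.+1 + r) shifted_word (3 * q).+1 i = 2 * q.+1 + r)%N.
Proof.
move=> r2; apply: (@addIn 1).
have : (\sum_(i < 3 * q.+1 + r) (shifted_word (3 * q).+1 i + (i == (3 * q).+1 :> nat)) =
        \sum_(i < 3 * q.+1 + r) (mod3_word i + (i == (3 * q).+2 :> nat)))%N.
  by apply: eq_bigr => i _; exact: shifted_wordE.
rewrite !big_split /= !sum_nat_eq mod3_word_sum; last by lia.
have -> : ((3 * q).+1 < 3 * q.+1 + r)%N by lia.
by have -> : ((3 * q).+2 < 3 * q.+1 + r)%N by lia.
Qed.

(** Position i lies in the edges starting at i and at i - 1; the guards drop the edge missing at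
    either end of the path. *)
Lemma edge_word_combination (R : pzRingType) m (y : nat -> R) i :
  \sum_(k < m) y k * (edge_word k i)%:R =
  (if (i < m)%N then y i else 0) +
  (if (0 < i <= m)%N then y i.-1 else 0).
Proof.
rewrite /edge_word; case: i => [|i] /=.
  by rewrite addr0 -sum_mul_eq; apply: eq_bigr => k _; rewrite orbF eq_sym.
rewrite -!sum_mul_eq -big_split /=; apply: eq_bigr => k _.
by rewrite -mulrDr -natrD eqSS; congr (_ * _%:R); lia.
Qed.

Lemma alternating_eq0 (R : zmodType) m (y : nat -> R) :
  y 0 = 0 -> (forall i, (i.+1 < m)%N -> y i.+1 + y i = 0) ->
  forall i, (i < m)%N -> y i = 0.
Proof.
move=> y0 yS; elim=> [//|i IH] im.
by have := yS i im; rewrite IH ?addr0 // ltnW.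
Qed.

(** * Dimension of the face when the fan is the whole graph *)

Section FanFacet.
Variables (R : realType) (V : finType) (G : sgraph V).
Variables (h : V) (n : nat) (f : nat -> V) (fanf : fan_on G h n f).
Hypothesis fan_cover : forall v, v = h \/ exists2 i, (i < n)%N & v = f i.

Lemma fan_card : #|V| = n.+1.
Proof.
rewrite -cardsT.
have -> : [set: V] = h |: [set f i | i : 'I_n].
  apply/setP => v; rewrite !inE; case: (fan_cover v) => [->|[i i_n ->]].
    by rewrite eqxx.
  by apply/esym/orP; right; apply/imsetP; exists (Ordinal i_n).
rewrite cardsU1 card_imset ?card_ord => [|i j fij]; last first.
  exact/val_inj/(fan_inj fanf (ltn_ord i) (ltn_ord j)).
case: imsetP => // -[i _ hE].
by have := fan_neq_hub fanf (ltn_ord i); rewrite -hE eqxx.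
Qed.

Definition fan_face (C B : nat) (x : vec R V) : Prop :=
  iuc_polytope R G x /\ fan_form h n f C%:R x = B%:R.

Lemma fan_set_in_face C B e g :
  (if e then all_consecutive n g else no_three_consecutive n g) ->
  (\sum_(i < n) g i + C * e = B)%N ->
  fan_face C B (incidence R (fan_set h n f e g)).
Proof.
move=> ge sumE; split.
  apply: conv_hull_sub; exists (fan_set h n f e g) => //.
  case: e ge sumE => ge _; first exact: (fan_set_hub_iuc fanf).
  exact: (fan_set_path_iuc fanf).
rewrite fan_form_incidence (mem_fan_set_hub fanf) -sumE; congr (_ + _)%N%:R.
by apply: eq_bigr => i _; rewrite (mem_fan_set fanf).
Qed.

(** The form is nonzero at the unit vector of the first path vertex, so the face lies in a
    hyperplane. *)
Lemma face_affinely_independent_leq C B m (p : 'I_m -> vec R V) :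
  (0 < n)%N -> (forall i, fan_face C B (p i)) -> affinely_independent p ->
  (m <= n.+1)%N.
Proof.
move=> n0 pF affp; rewrite -fan_card.
apply: (affinely_independent_hyperplane (x := incidence R [set f 0%N]) affp
  (fan_form_scalar h n f C%:R) (fun i => (pF i).2)).
have hf0 : (h \in [set f 0%N]) = false.
  by rewrite inE eq_sym (negPf (fan_neq_hub fanf n0)).
rewrite fan_form_incidence hf0 muln0 addn0.
rewrite pnatr_eq0 -lt0n (bigD1 (Ordinal n0)) //= inE eqxx; lia.
Qed.

(* Comparing coordinates along the path, the coefficients of the edge sets
   alternate in sign away from the positions 3q + 1 and 3q + 2 where the two
   words differ (so they vanish up to 3q), while the coefficient e of the first
   word makes them -e and 2e at these positions; the end of the path then
   forces e = 0. *)
Lemma fan_face_has_dim q r :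
  n = (3 * q.+1 + r)%N -> (r < 2)%N ->
  has_dim (fan_face (2 * q + r) (2 * q.+1 + r)) (#|V|%:Z - 1).
Proof.
(* The q of the theorem is [q.+1] here, and [m] counts the edges of the path. *)
move=> nE r2; have [m nm] : exists m, n = m.+1 by exists n.-1; lia.
(* Indices below [m] give the hub with an edge; the last two give the two maximum words without the
   hub. *)
pose g k := if (k < m)%N then edge_word k
            else if k == m then mod3_word else shifted_word (3 * q).+1.
pose U k := fan_set h n f (k < m)%N (g k).
exists n.+1; rewrite fan_card; split=> [//||p l]; last first.
  by apply: face_affinely_independent_leq; lia.
rewrite nm; exists (fun k : 'I_m.+2 => incidence R (U k)); split=> [k|c c0 cU].
  apply: fan_set_in_face; rewrite /g; case: ltnP => [km|_].
  - exact: edge_word_consecutive.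
  - case: eqP => _; first exact: mod3_word_no_three.
    by rewrite nE; exact: shifted_word_no_three.
  - by by rewrite edge_word_sum ?muln1; lia.
  - rewrite muln0 addn0 nE; case: eqP => _; last by rewrite shifted_word_sum.
    by rewrite mod3_word_sum //; lia.
pose e k := c (inord k).
have splitE (F : nat -> R) : \sum_k c k * F k =
    \sum_(k < m) e k * F k + e m * F m + e m.+1 * F m.+1.
  transitivity (\sum_(k < m.+2) e k * F k).
    by apply: eq_bigr => k _; rewrite /e inord_val.
  by rewrite !big_ord_recr.
have coordU v : \sum_(k < m) e k * (v \in U k)%:R + e m * (v \in U m)%:R
    + e m.+1 * (v \in U m.+1)%:R = 0.
  move/ffunP/(_ v): cU; rewrite sum_ffunE ffunE => cUv; rewrite -[RHS]cUv.
  rewrite -[LHS](splitE (fun k => (v \in U k)%:R)).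
  by apply: eq_bigr => k _; rewrite !ffunE.
(* Exactly the edge sets contain the hub, so its coordinate sums their coefficients. *)
have sum_e : \sum_(k < m) e k = 0.
  have := coordU h; rewrite /U !(mem_fan_set_hub fanf) ltnn ltnNge leqnSn !mulr0 !addr0.
  by under eq_bigr => k _ do rewrite (mem_fan_set_hub fanf) ltn_ord mulr1.
(* All coefficients together sum to zero as well, so the two words enter only through their
   difference. *)
have e_opp : e m.+1 = - e m.
  have := splitE (fun=> 1); rewrite /= -!mulr_suml !mulr1 c0 sum_e add0r addrC.
  by move/esym/eqP; rewrite addr_eq0 => /eqP.
(* Extension by zero lets one recurrence cover the last path vertex, where no edge starts. *)
pose y k := if (k < m)%N then e k else 0.
have coord i : (i < n)%N ->
    y i + (if (0 < i)%N then y i.-1 else 0) =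
    e m * ((i == (3 * q).+2)%:R - (i == (3 * q).+1)%:R).
  move=> i_n; have := coordU (f i).
  rewrite /U !(mem_fan_set fanf) // /g ltnn eqxx ltnNge leqnSn gtn_eqF //= e_opp.
  under eq_bigr => k _ do rewrite (mem_fan_set fanf) // ltn_ord.
  rewrite edge_word_combination.
  have := shifted_wordE q i => /(congr1 (fun k => k%:R : R)); rewrite !natrD.
  have -> : (0 < i <= m)%N = (0 < i)%N by lia.
  have yE : (if (0 < i)%N then if (i.-1 < m)%N then e i.-1 else 0 else 0) =
            (if (0 < i)%N then e i.-1 else 0).
    by case: ifP => // i0; have -> : (i.-1 < m)%N by lia.
  rewrite /y yE => wE sum0.
  have solve (t a s w p1 p2 : R) :
      s + p1 = w + p2 -> t + a * w + - a * s = 0 -> t = a * (p2 - p1).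
    move=> sw tw; have -> : p2 = s + p1 - w by rewrite sw addrC addKr.
    by apply/eqP; rewrite -subr_eq0 -[X in _ == X]tw; apply/eqP; ring.
  exact: solve wE sum0.
have y_beyond i : (m <= i)%N -> y i = 0 by rewrite /y ltnNge => ->.
have coord0 : y 0 = 0.
  by have := coord 0%N; rewrite /= addr0 subrr mulr0; apply; lia.
have coordS i : (i.+1 < n)%N -> y i.+1 + y i =
    e m * ((i == (3 * q).+1)%:R - (i == 3 * q)%N%:R) by exact: coord.
have y_small : y (3 * q)%N = 0.
  apply: (@alternating_eq0 _ (3 * q).+1) => // i i_q.
  rewrite coordS; last by lia.
  have -> : (i == (3 * q).+1) = false by lia.
  by have -> : (i == 3 * q)%N = false; [lia | rewrite subrr mulr0].
have y1 : y (3 * q).+1 = - e m.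
  have := coordS (3 * q)%N; rewrite y_small addr0 eqxx ltn_eqF // sub0r mulrN1.
  by apply; lia.
have y2 : y (3 * q).+2 = e m *+ 2.
  have := coordS (3 * q).+1; rewrite y1 eqxx gtn_eqF // subr0 mulr1 => y2.
  by rewrite mulr2n -[X in X + _]y2 ?subrK //; lia.
have em0 : e m = 0.
  suff : y (3 * q).+2 = 0.
    by rewrite y2 => /eqP; rewrite -mulr_natr mulf_eq0 pnatr_eq0 orbF => /eqP.
  (* For r = 0, position 3q + 2 is the last path vertex, where no edge starts. For r = 1, the
     equation at the last vertex 3q + 3 gives the vanishing. *)
  case: r r2 nE => [|[|//]] _ nE; first by apply: y_beyond; lia.
  have := coordS (3 * q).+2; rewrite (y_beyond (3 * q).+3) ?add0r; last by lia.
  have -> : ((3 * q).+2 == (3 * q).+1) = false by lia.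
  have -> : ((3 * q).+2 == 3 * q)%N = false by lia.
  by rewrite subrr mulr0; apply; lia.
have y_eq0 : forall i, (i < n)%N -> y i = 0.
  by apply: alternating_eq0 => // i i_n; rewrite coordS // em0 mul0r.
have e0 k : (k < m.+2)%N -> e k = 0.
  rewrite ltnS leq_eqVlt => /orP[/eqP->|]; first by rewrite e_opp em0 oppr0.
  rewrite ltnS leq_eqVlt => /orP[/eqP->//|km].
  by have := y_eq0 k; rewrite /y km; apply; lia.
by move=> k; rewrite -(e0 k (ltn_ord k)) /e inord_val.
Qed.

(** Convexity carries the alternating equation from the tight IUCs to the whole face. *)
Lemma alt_fan_face q : n = (3 * q + 2)%N -> (0 < q)%N ->
  forall x, fan_face (2 * (q - 1) + 2) (2 * q + 2) x -> alt_form n f x = 0.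
Proof.
move=> nE q0 x [Sx]; apply: conv_hull_face x Sx.
- exact: fan_form_scalar.
- exact: alt_form_scalar.
- by move=> _ [U iucU ->]; rewrite fan_form_incidence ler_nat (fan_iuc_leq fanf).
move=> _ [U iucU ->]; rewrite fan_form_incidence => /eqP.
by rewrite eqr_nat => /eqP; exact: (fan_iuc_tight_alt R fanf).
Qed.

(** Two independent equations leave fewer than |V| affinely independent points, whereas dimension
    |V| - 1 asks for |V|. *)
Lemma fan_face_not_has_dim q : n = (3 * q + 2)%N -> (0 < q)%N ->
  ~ has_dim (fan_face (2 * (q - 1) + 2) (2 * q + 2)) (#|V|%:Z - 1).
Proof.
move=> nE q0 [m [mE [p [pF affp]] _]].
suff : (m < #|V|)%N by lia.
apply: (affinely_independent_codim2 affp (fan_form_scalar h n f _)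
  (alt_form_scalar n f) (fun i => (pF i).2) (fun i => alt_fan_face nE q0 (pF i))).
move=> d1 d2 free12.
(* Independence is tested on unit vectors: the first two path vertices give d1 + d2 = 0 and d1 - d2
   = 0. *)
pose U k := fan_set h n f false (fun i => i == k).
have eqU k : (k < n)%N -> d1 + d2 * (-1) ^+ k = 0.
  move=> kn; have := free12 (incidence R (U k)).
  rewrite fan_form_incidence (mem_fan_set_hub fanf) muln0 addn0.
  have -> : (\sum_(i < n) (f i \in U k) = 1)%N.
    transitivity (\sum_(i < n) (i == k :> nat))%N; last by rewrite sum_nat_eq kn.
    by apply: eq_bigr => i _; rewrite (mem_fan_set fanf).
  have -> : alt_form n f (incidence R (U k)) = (-1) ^+ k.
    transitivity (\sum_(i < n) (-1) ^+ i * (i == k :> nat)%:R : R).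
      by apply: eq_bigr => i _; rewrite ffunE (mem_fan_set fanf).
    by rewrite (sum_mul_eq n k (fun i => (-1) ^+ i)) kn.
  by rewrite mulr1.
have n1 : (1 < n)%N by lia.
by have := eqU 0%N (ltnW n1); have := eqU 1%N n1; rewrite expr0 expr1; split; lra.
Qed.

End FanFacet.

(** * Indexing an induced fan, and passing to G[F] *)

Lemma induces_fan_on (V : finType) (G : sgraph V) (h : V) (P : {set V}) :
  induces_fan G h P -> (0 < #|P|)%N ->
  exists2 f, fan_on G h #|P| f & P = [set f i | i : 'I_#|P|].
Proof.
move=> [hP [n [f [bij_f adj_f]]] adj_h] P0.
have nE : n = #|P|.
  by rewrite -[LHS]card_ord (bij_eq_card bij_f) card_sig; apply: eq_card.
(* [inord] needs an index type of successor size; its default value concerns only indices outside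
   the path. *)
rewrite -nE in P0 *; case: n P0 f bij_f adj_f nE => // n _ f bij_f adj_f nE.
exists (fun k => val (f (inord k))).
  split=> [i j i_n jn /val_inj/(bij_inj bij_f)/(congr1 val)|i i_n|i j i_n jn|i i_n].
  - by rewrite /= !inordK.
  - by apply: contraNneq hP => <-; exact: valP.
  - by have := adj_f (inord i) (inord j); rewrite /= !inordK.
  - exact/adj_h/valP.
apply/setP => v; apply/idP/imsetP => [vP|[i _ ->]]; last exact: valP.
have [g _ fg] := bij_f.
by exists (g (exist _ v vP)) => //; rewrite inord_val fg.
Qed.

Section InducedFan.
Variables (V : finType) (G : sgraph V) (h : V) (P : {set V}) (f : nat -> V).
Hypotheses (fanf : fan_on G h #|P| f) (Pf : P = [set f i | i : 'I_#|P|]).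

(** The hub is the default when [f i] leaves the fan, which never happens for i < |P|. *)
Definition induced_fan_fun (i : nat) : {x : V | x \in h |: P} :=
  insubd (fan_hub h P) (f i).

Lemma fan_fun_in_path i : (i < #|P|)%N -> f i \in P.
Proof. by move=> iP; rewrite Pf; apply/imsetP; exists (Ordinal iP). Qed.

Lemma val_induced_fan_fun i : (i < #|P|)%N -> val (induced_fan_fun i) = f i.
Proof.
by move=> iP; rewrite val_insubd finset.in_setU (fan_fun_in_path iP) orbT.
Qed.

Lemma induced_fan_on :
  fan_on (induced G (h |: P)) (fan_hub h P) #|P| induced_fan_fun.
Proof.
split=> [i j iP jP|i iP|i j iP jP|i iP].
- move/(congr1 val); rewrite !val_induced_fan_fun //; exact: (fan_inj fanf).
- by rewrite -val_eqE val_induced_fan_fun // (fan_neq_hub fanf).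
- by rewrite /= !val_induced_fan_fun // (fan_adj fanf).
- by rewrite /= val_induced_fan_fun // (fan_adj_hub fanf).
Qed.

Lemma fan_path_image : fan_path h P = [set induced_fan_fun i | i : 'I_#|P|].
Proof.
apply/setP => v; rewrite inE; apply/idP/imsetP => [|[i _ ->]]; last first.
  by rewrite val_induced_fan_fun // fan_fun_in_path.
move=> vP; have : val v \in [set f i | i : 'I_#|P|] by rewrite -Pf.
case/imsetP=> i _ vi; exists i => //.
by apply: val_inj; rewrite val_induced_fan_fun.
Qed.

Lemma induced_fan_cover v :
  v = fan_hub h P \/ exists2 i, (i < #|P|)%N & v = induced_fan_fun i.
Proof.
have := valP v; rewrite finset.in_setU1 => /orP[/eqP vh|vP].
  by left; exact: val_inj.
have : v \in fan_path h P by rewrite inE.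
by rewrite fan_path_image => /imsetP[i _ ->]; right; exists i.
Qed.

End InducedFan.

(** * Validity and the facet criterion *)

Unset Implicit Arguments.

Theorem theorem13 (R : realType) (V : finType) (G : sgraph V)
    (h : V) (P : {set V}) (q r : nat)
    (hfan : induces_fan G h P) (hP4 : (4 <= #|P|)%N)
    (hPqr : #|P| = (3 * q + r)%N) (hq : (0 < q)%N) (hr : (r < 3)%N) :
  let c : R := (2 * (q - 1) + (2 * (r + 1)) %/ 3)%N%:R in
  let b : R := (2 * q + (2 * (r + 1)) %/ 3)%N%:R in
  valid_ineq (iuc_polytope R G) (fan_lhs P h c) b /\
  (facet_inducing (iuc_polytope R (induced G (h |: P)))
     (fan_lhs (fan_path h P) (fan_hub h P) c) b
   <-> r <> 2%N).
Proof.
(* For r = 0, 1, 2 the quotients 2/3, 4/3, 6/3 round down to 0, 1, 2. *)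
have -> : ((2 * (r + 1)) %/ 3 = r)%N by lia.
move=> c b.
have [f fanf Pf] := induces_fan_on hfan (ltn_trans (isT : 0 < 3)%N hP4).
have fanf' := induced_fan_on fanf Pf.
have -> : fan_lhs P h c = fan_form h #|P| f c.
  by apply: boolp.funext => x; exact: (fan_lhsE fanf).
have -> : fan_lhs (fan_path h P) (fan_hub h P) c =
    fan_form (fan_hub h P) #|P| (induced_fan_fun h P f) c.
  by apply: boolp.funext => x; apply: (fan_lhsE fanf'); exact: fan_path_image Pf.
split; first exact: (fan_form_valid fanf hPqr hq).
have dimS := iuc_polytope_has_dim R (induced G (h |: P)).
have coverF := induced_fan_cover (h := h) Pf.
split=> [[_ [d [dimd dimF]]] r2|r2].
  rewrite (has_dim_uniq dimd dimS) in dimF; subst r.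
  exact: (fan_face_not_has_dim fanf' hPqr hq dimF).
split; first exact: (fan_form_valid fanf' hPqr hq).
eexists; split; first exact: dimS.
(* Replacing q by q + 1 turns the truncated 2(q - 1) into 2q, as in the dimension lemma. *)
case: q hq hPqr @c @b => // q _ hPqr c b.
have := fan_face_has_dim R fanf' coverF hPqr; rewrite /fan_face /c /b subn1; apply; lia.
Qed.
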